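(* Let $\mathcal{C}$ be an ACTEP and let $c_l$ ($l\ge 0$) denote the virtual characteristic classes. For all integers $l\ge 0$ the following hold. (1) For all $x,y\in K_0(\mathcal{C})$, $\;c_l(x+y)=\sum_{i+j=l}c_i(x)c_j(y)$. (2) If $x\in K_0(\mathcal{C})$ is effective and $l>e(x)$, then $c_l(x)=0$. (3) For every morphism $f:\mathcal{D}\to\mathcal{C}$ in $\underline{Cat}^{\otimes}_{\wedge}$ and every $x\in K_0(\mathcal{D})$, $\;f^*(c_l(x))=c_l(f^*(x))$.
   Context: An abelian category with tensor and exterior products (ACTEP) is a small abelian category $\mathcal{C}$ with the following structure. (1) A tensor product $\otimes:\mathcal{C}\times\mathcal{C}\to\mathcal{C}$ such that $\{\mathcal{C},\oplus,\otimes\}$ is an abelian tensor category: there are canonical isomorphisms $x\otimes y\cong y\otimes x$ and $(x\oplus y)\otimes z\cong (x\otimes z)\oplus (y\otimes z)$, a unique unit object $\mathbf{1}^{\otimes}$ with canonical isomorphisms $\mathbf{1}^{\otimes}\otimes x\cong x\otimes \mathbf{1}^{\otimes}\cong x$, and for each object $x$ the endofunctor $x\otimes -$ is exact. (2) A function $rk:Ob(\mathcal{C})\to\mathbb{N}$ with $rk(\mathbf{1}^{\otimes})=1$, additive on exact sequences. (3) For every $k\ge 0$ an endofunctor $\lambda^k:\mathcal{C}\to\mathcal{C}$ (exterior product) with $\lambda^i(x)=0$ for $i>rk(x)$, $\lambda^0(x)=\mathbf{1}^{\otimes}$, $\lambda^1(x)=x$, and such that for any exact sequence $0\to x'\to x\to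 x''\to 0$ in $\mathcal{C}$ and any $p\ge 2$ there is a filtration $0=F_{p+1}\subseteq F_p\subseteq\cdots\subseteq F_1\subseteq F_0=\lambda^p(x)$ with canonical isomorphisms $F_i/F_{i+1}\cong\lambda^i(x')\otimes\lambda^{p-i}(x'')$. A morphism of ACTEP's $f:\mathcal{D}\to\mathcal{C}$ is an additive tensor functor commuting with exterior products, i.e. with canonical isomorphisms $f(\lambda^l(x))\cong\lambda^l(f(x))$ for all $l\ge 0$. The category $\underline{Cat}^{\otimes}_{\wedge}$ has ACTEP's as objects and morphisms of ACTEP's as morphisms. $K_0(\mathcal{C})$ is the Grothendieck group of $\mathcal{C}$ (with respect to short exact sequences), with addition induced by $\oplus$, multiplication induced by $\otimes$, and unit $[\mathbf{1}^{\otimes}]$. A morphism $f:\mathcal{D}\to\mathcal{C}$ induces a ring map $f^*:K_0(\mathcal{D})\to K_0(\mathcal{C})$, $[x]\mapsto[f(x)]$. For an object $x$ put $\lambda_t(x)=\sum_{l\ge 0}[\lambda^l(x)]t^l\in 1+K_0(\mathcal{C})[[t]]$, the multiplicative group of power series with constant term $1$. This extends to a group homomorphism $\lambda_t:K_0(\mathcal{C})\to 1+K_0(\mathcal{C})[[t]]$ with $\lambda_t(n[x]-m[y])=\lambda_t(x)^n\lambda_t(y)^{-m}$, and $\lambda^l(\omega)$ is defined by $\lambda_t(\omega)=\sum_{l\ge 0}\lambda^l(\omega)t^l$. With $u=t/(1-t)$, the gamma operations $\gamma^l$ are defined by $\gamma_t(\omega)=\lambda_u(\omega)=\sum_{l\ge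 0}\lambda^l(\omega)u^l=\sum_{l\ge 0}\gamma^l(\omega)t^l$. For $\omega=\sum_i n_i[x_i]\in K_0(\mathcal{C})$ put $e(\omega)=\sum_i n_i\,rk(x_i)\in\mathbb{Z}$, $d(\omega)=e(\omega)[\mathbf{1}^{\otimes}]\in K_0(\mathcal{C})$, and for $l\ge 0$ define the $l$-th virtual characteristic class $$c_l(\omega)=(-1)^l\gamma^l(\omega-d(\omega))\in K_0(\mathcal{C}).$$ An element $\omega$ is effective if it can be written $\omega=\sum_i n_i[x_i]$ with $n_i\ge 1$ for all $i$.
   Formalization: In (3), morphisms are also required to preserve rank, rk(f(x)) = rk(x), without which (3) fails already for c_1, and [x] ↦ [f(x)] is required to be additive on short exact sequences so that f^* is well defined. *)

(* Defs.v *)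
From HB Require Import structures.
From mathcomp Require Import all_boot all_order.
From mathcomp Require Import ssralg ssrnum ssrint poly ring_quotient generic_quotient.
From mathcomp.multinomials Require Import freeg.
From mathcomp Require Import boolp functions.

Set Implicit Arguments.
Unset Strict Implicit.
Unset Printing Implicit Defensive.

Import Order.TTheory GRing.Theory Num.Theory.
Local Open Scope ring_scope.

Record preaddCat := PreaddCat {
  ob :> Type;
  hom : ob -> ob -> zmodType;
  idm : forall x, hom x x;
  compm : forall x y z, hom y z -> hom x y -> hom x z;
  compmA : forall w x y z (h : hom y z) (g : hom x y) (f : hom w x),
    compm h (compm g f) = compm (compm h g) f;
  comp1m : forall x y (f : hom x y), compm (idm y) f = f;
  compm1 : forall x y (f : hom x y), compm f (idm x) = f;
  compmDl : forall x y z (g h : hom y z) (f : hom x y),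
    compm (g + h) f = compm g f + compm h f;
  compmDr : forall x y z (h : hom y z) (f g : hom x y),
    compm h (f + g) = compm h f + compm h g }.

Arguments idm {p} x.
Arguments compm {p x y z} _ _.
Notation "g \oc f" := (compm g f) (at level 40, left associativity).

Section PreaddCatNotions.
Variable C : preaddCat.
Implicit Types x y z w : C.

Definition is_zero x :=
  (forall y (f : hom x y), f = 0) /\ (forall y (f : hom y x), f = 0).

Definition is_iso x y (f : hom x y) :=
  exists g : hom y x, g \oc f = idm x /\ f \oc g = idm y.

Definition isomorphic x y := exists f : hom x y, is_iso f.

Definition is_mono x y (f : hom x y) :=
  forall w (g h : hom w x), f \oc g = f \oc h -> g = h.

Definition is_epi x y (f : hom x y) :=
  forall w (g h : hom y w), g \oc f = h \oc f -> g = h.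

Definition is_kernel x y k (f : hom x y) (i : hom k x) :=
  f \oc i = 0 /\
  forall w (h : hom w x), f \oc h = 0 -> exists! u : hom w k, i \oc u = h.

Definition is_cokernel x y q (f : hom x y) (p : hom y q) :=
  p \oc f = 0 /\
  forall w (h : hom y w), h \oc f = 0 -> exists! u : hom q w, u \oc p = h.

Definition short_exact x' x x'' (f : hom x' x) (g : hom x x'') :=
  is_kernel g f /\ is_cokernel f g.

End PreaddCatNotions.

Record abelianCat := AbelianCat {
  acat :> preaddCat;
  zob : acat;
  zobP : is_zero zob;
  dsum : acat -> acat -> acat;
  inj1 : forall x y, hom x (dsum x y);
  inj2 : forall x y, hom y (dsum x y);
  prj1 : forall x y, hom (dsum x y) x;
  prj2 : forall x y, hom (dsum x y) y;
  prj1_inj1 : forall x y, prj1 x y \oc inj1 x y = idm x;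
  prj2_inj2 : forall x y, prj2 x y \oc inj2 x y = idm y;
  prj1_inj2 : forall x y, prj1 x y \oc inj2 x y = 0;
  prj2_inj1 : forall x y, prj2 x y \oc inj1 x y = 0;
  inj_prj : forall x y,
    inj1 x y \oc prj1 x y + inj2 x y \oc prj2 x y = idm (dsum x y);
  has_kernels : forall (x y : acat) (f : hom x y),
    exists (k : acat) (i : hom k x), is_kernel f i;
  has_cokernels : forall (x y : acat) (f : hom x y),
    exists (q : acat) (p : hom y q), is_cokernel f p;
  mono_normal : forall (x y : acat) (i : hom x y), is_mono i ->
    exists (z : acat) (f : hom y z), is_kernel f i;
  epi_normal : forall (x y : acat) (p : hom x y), is_epi p ->
    exists (z : acat) (f : hom z x), is_cokernel f p }.

Arguments zob {_}.
Arguments dsum {_} x y.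
Arguments inj1 {_} x y.
Arguments inj2 {_} x y.
Arguments prj1 {_} x y.
Arguments prj2 {_} x y.

(* Functors need not be additive: exterior powers are not. *)
Record functor (C D : preaddCat) := Functor {
  fob :> C -> D;
  fmap : forall x y : C, hom x y -> hom (fob x) (fob y);
  fmap1 : forall x : C, fmap (idm x) = idm (fob x);
  fmapC : forall (x y z : C) (g : hom y z) (f : hom x y),
    fmap (g \oc f) = fmap g \oc fmap f }.

(* Distributivity, [tens_dsum], says that the canonical map
   (x \tens z) (+) (y \tens z) -> (x (+) y) \tens z is an isomorphism; with
   [tens_exact] it makes [tens] biadditive. *)
Record tensorCat := TensorCat {
  tcat :> abelianCat;
  tunit : tcat;
  tens : tcat -> tcat -> tcat;
  tensm : forall x y x' y' : tcat,
    hom x x' -> hom y y' -> hom (tens x y) (tens x' y');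
  tensm1 : forall x y, tensm (idm x) (idm y) = idm (tens x y);
  tensmC : forall (x x' x'' y y' y'' : tcat) (f' : hom x' x'') (f : hom x x')
      (g' : hom y' y'') (g : hom y y'),
    tensm (f' \oc f) (g' \oc g) = tensm f' g' \oc tensm f g;
  tassoc : forall x y z, hom (tens (tens x y) z) (tens x (tens y z));
  tassoc_iso : forall x y z, is_iso (tassoc x y z);
  tassoc_nat : forall (x y z x' y' z' : tcat) (f : hom x x') (g : hom y y')
      (h : hom z z'),
    tassoc x' y' z' \oc tensm (tensm f g) h =
    tensm f (tensm g h) \oc tassoc x y z;
  tbraid : forall x y, hom (tens x y) (tens y x);
  tbraidK : forall x y, tbraid y x \oc tbraid x y = idm (tens x y);
  tbraid_nat : forall (x y x' y' : tcat) (f : hom x x') (g : hom y y'),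
    tbraid x' y' \oc tensm f g = tensm g f \oc tbraid x y;
  tunitl : forall x, hom (tens tunit x) x;
  tunitl_iso : forall x, is_iso (tunitl x);
  tunitl_nat : forall (x y : tcat) (f : hom x y),
    tunitl y \oc tensm (idm tunit) f = f \oc tunitl x;
  tunitr : forall x, hom (tens x tunit) x;
  tunitr_iso : forall x, is_iso (tunitr x);
  tunitr_nat : forall (x y : tcat) (f : hom x y),
    tunitr y \oc tensm f (idm tunit) = f \oc tunitr x;
  pentagon : forall w x y z,
    tassoc w x (tens y z) \oc tassoc (tens w x) y z =
    tensm (idm w) (tassoc x y z) \oc tassoc w (tens x y) z
      \oc tensm (tassoc w x y) (idm z);
  triangle : forall x y,
    tensm (idm x) (tunitl y) \oc tassoc x tunit y = tensm (tunitr x) (idm y);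
  hexagon : forall x y z,
    tassoc y z x \oc tbraid x (tens y z) \oc tassoc x y z =
    tensm (idm y) (tbraid x z) \oc tassoc y x z
      \oc tensm (tbraid x y) (idm z);
  tens_dsum : forall x y z : tcat,
    is_iso (tensm (inj1 x y) (idm z) \oc prj1 (tens x z) (tens y z)
          + tensm (inj2 x y) (idm z) \oc prj2 (tens x z) (tens y z));
  tens_exact : forall (x y' y y'' : tcat) (f : hom y' y) (g : hom y y''),
    short_exact f g -> short_exact (tensm (idm x) f) (tensm (idm x) g) }.

Arguments tunit {_}.
Arguments tens {_} x y.
Arguments tensm {_ _ _ _ _} f g.
Notation "x \tens y" := (tens x y) (at level 40, left associativity).

(* F_i is a subobject of [ext p x] through [m i], contained in the previous
   one through [j i]; the last clause says F_i / F_{i+1} is isomorphic to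
   ext i x' \tens ext (p - i) x''. Nothing is asked about how F varies with the
   exact sequence. *)
Definition ext_filtration (C : tensorCat) (ext : nat -> functor C C) (p : nat)
    (x' x x'' : C) : Prop :=
  exists (F : nat -> C) (m : forall i, hom (F i) (ext p x))
         (j : forall i, hom (F i.+1) (F i)),
    [/\ is_iso (m 0),
        is_zero (F p.+1)
      & forall i, (i <= p)%N ->
        [/\ is_mono (m i), m i \oc j i = m i.+1
          & exists q : hom (F i) (ext i x' \tens ext (p - i)%N x''),
              short_exact (j i) q]].

(* Equalities between objects (ext 0 x = 1, ext 1 x = x) are read up to
   isomorphism. *)
Record ACTEP := MkACTEP {
  tensorcat :> tensorCat;
  rk : tensorcat -> nat;
  rk_unit : rk tunit = 1%N;
  rk_exact : forall (x' x x'' : tensorcat) (f : hom x' x) (g : hom x x''),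
    short_exact f g -> rk x = (rk x' + rk x'')%N;
  ext : nat -> functor tensorcat tensorcat;
  ext_gt_rk : forall i x, (rk x < i)%N -> is_zero (ext i x);
  ext0 : forall x, isomorphic (ext 0 x) tunit;
  ext1 : forall x, isomorphic (ext 1 x) x;
  ext_filt : forall (x' x x'' : tensorcat) (f : hom x' x) (g : hom x x''),
    short_exact f g -> forall p, (2 <= p)%N -> ext_filtration ext p x' x x'' }.

Arguments rk {_} x.
Arguments ext {_} k.

Section GrothendieckGroup.
Variable C : ACTEP.

Definition fobj (x : C) : {freeg {classic C} / int} :=
  << 1 *g (x : {classic C}) >>.

(* Subgroup generated by the [x] - [x'] - [x''], 0 -> x' -> x -> x'' -> 0. *)
Inductive ses_span : {freeg {classic C} / int} -> Prop :=
| ses_span0 : ses_span 0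
| ses_spanB a b : ses_span a -> ses_span b -> ses_span (a - b)
| ses_span_gen (x' x x'' : C) (f : hom x' x) (g : hom x x'') :
    short_exact f g -> ses_span (fobj x - fobj x' - fobj x'').

Definition ses_rel : {pred {freeg {classic C} / int}} := fun a => `[< ses_span a >].

Lemma ses_rel_zmod_closed : zmod_closed ses_rel.
Proof.
split=> [|a b]; first exact/asboolP/ses_span0.
by move=> /asboolP ha /asboolP hb; exact/asboolP/ses_spanB.
Qed.

HB.instance Definition _ := GRing.isZmodClosed.Build _ ses_rel ses_rel_zmod_closed.

Definition K0 : Type := Quotient.quot ses_rel.
HB.instance Definition _ := Choice.on K0.
HB.instance Definition _ := GRing.Zmodule.on K0.

Definition K0_pi (a : {freeg {classic C} / int}) : K0 :=
  \pi_(Quotient.quot ses_rel)%qT a.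

Definition cls (x : C) : K0 := K0_pi (fobj x).

End GrothendieckGroup.

Section K0Lift.
Variable C : ACTEP.

Definition ses_additive (V : zmodType) (phi : C -> V) :=
  forall (x' x x'' : C) (f : hom x' x) (g : hom x x''),
    short_exact f g -> phi x = phi x' + phi x''.

Variables (V : zmodType) (phi : C -> V) (phiD : ses_additive phi).

Definition free_lift (a : {freeg {classic C} / int}) : V :=
  fglift (fun x : {classic C} => phi x : zmodule V) a.

(* The homomorphism K0 C -> V with [x] |-> phi x. *)
Definition K0_lift of ses_additive phi := fun a : K0 C =>
  free_lift (repr (a : Quotient.quot (@ses_rel C))).

Lemma free_lift_is_additive : zmod_morphism free_lift.
Proof. by move=> a b; have H := @lift_is_additive int _ (zmodule V) (fun x : {classic C} => phi x). Qed.

HB.instance Definition _ :=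
  GRing.isZmodMorphism.Build _ V free_lift free_lift_is_additive.

Lemma free_liftE x : free_lift (fobj x) = phi x.
Proof. by rewrite /free_lift /fobj liftU scale1r. Qed.

Lemma free_lift_span a : ses_span a -> free_lift a = 0.
Proof.
elim=> [|b c _ hb _ hc|x' x x'' f g s]; first exact: raddf0.
  by rewrite raddfB /= hb hc subr0.
by rewrite !raddfB /= !free_liftE (phiD s) addrAC addrK subrr.
Qed.

Lemma K0_lift_pi a : K0_lift phiD (K0_pi a) = free_lift a.
Proof.
apply/eqP; rewrite -subr_eq0 -raddfB; apply/eqP/free_lift_span.
by apply/asboolP; rewrite -[X in is_true X]/(_ \in @ses_rel C) Quotient.idealrBE reprK.
Qed.
End K0Lift.

Section K0Theory.
Variable C : ACTEP.

Lemma K0_pi_is_additive : zmod_morphism (@K0_pi C).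
Proof. by move=> a b; rewrite /K0_pi !piE. Qed.
HB.instance Definition _ :=
  GRing.isZmodMorphism.Build _ (K0 C) (@K0_pi C) K0_pi_is_additive.

Lemma K0_piK (a : K0 C) : exists b, a = K0_pi b.
Proof. by exists (repr (a : Quotient.quot (@ses_rel C))); rewrite /K0_pi reprK. Qed.

Lemma K0_lift_is_additive (V : zmodType) (phi : C -> V) (phiD : ses_additive phi) :
  zmod_morphism (K0_lift phiD).
Proof.
move=> a b; have [a' ->] := K0_piK a; have [b' ->] := K0_piK b.
by rewrite -raddfB !K0_lift_pi raddfB.
Qed.
HB.instance Definition _ V phi phiD := GRing.isZmodMorphism.Build _ _
  (@K0_lift C V phi phiD) (K0_lift_is_additive phiD).

Lemma K0_liftE (V : zmodType) (phi : C -> V) (phiD : ses_additive phi) x :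
  K0_lift phiD (cls x) = phi x.
Proof. by rewrite K0_lift_pi free_liftE. Qed.

Lemma K0_ind (P : K0 C -> Prop) :
    (forall x, P (cls x)) -> (forall a b, P a -> P b -> P (a - b)) ->
  forall a, P a.
Proof.
move=> Pc PB a.
have P0 : P 0 by rewrite -(subrr (cls (zob : C))); apply: PB.
have PN b : P b -> P (- b) by move=> hb; rewrite -sub0r; apply: PB.
have PD b c : P b -> P c -> P (b + c).
  by move=> hb hc; rewrite -[c]opprK; apply: PB => //; apply: PN.
have PMn b n : P b -> P (b *+ n).
  by move=> hb; elim: n => [|n IH]; rewrite ?mulr0n // mulrS; apply: PD.
have [b ->] := K0_piK a; rewrite -(freeg_sumE b) raddf_sum.
apply: (big_ind P) => // x _.
have -> : << coeff x b *g x >> = fobj (x : C) *~ coeff x b.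
  by rewrite /fobj freeg_mulz intz.
rewrite raddfMz; case: (coeff x b) => n; first exact/PMn/Pc.
by rewrite NegzE mulrNz; apply/PN/PMn/Pc.
Qed.

Lemma cls_ses : ses_additive (@cls C).
Proof.
move=> x' x x'' f g s; apply/eqP; rewrite -subr_eq0 opprD addrA.
rewrite /cls -!raddfB -[0](raddf0 (@K0_pi C)) /K0_pi -Quotient.idealrBE subr0.
exact/asboolP/ses_span_gen/s.
Qed.

Lemma hom_into_zero (z x : C) (f : hom x z) : is_zero z -> f = 0.
Proof. by case=> _; apply. Qed.

Lemma hom_from_zero (z x : C) (f : hom z x) : is_zero z -> f = 0.
Proof. by case=> + _; apply. Qed.

Lemma compm0 (x y z : C) (g : hom y z) : g \oc (0 : hom x y) = 0.
Proof. by apply: (addrI (g \oc 0)); rewrite -compmDr !addr0. Qed.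

Lemma comp0m (x y z : C) (f : hom x y) : (0 : hom y z) \oc f = 0.
Proof. by apply: (addrI (0 \oc f)); rewrite -compmDl !addr0. Qed.

Lemma iso_ses (z x y : C) (f : hom x y) : is_zero z -> is_iso f ->
  short_exact (0 : hom z x) f.
Proof.
move=> hz [g [gf fg]]; split; split; rewrite ?compm0 //.
  move=> w h fh; have h0 : h = 0 by rewrite -(comp1m h) -gf -compmA fh compm0.
  exists 0; split=> [|u _]; first by rewrite comp0m.
  by rewrite (hom_into_zero u hz).
move=> w h _; exists (h \oc g); split=> [|u <-]; first by rewrite -compmA gf compm1.
by rewrite -compmA fg compm1.
Qed.

Lemma cls_zero (z : C) : is_zero z -> cls z = 0.
Proof.
move=> hz; have i : is_iso (idm z) by exists (idm z); rewrite comp1m.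
by have /eqP := cls_ses (iso_ses hz i); rewrite -subr_eq subrr eq_sym => /eqP.
Qed.

Lemma cls_iso (x y : C) : isomorphic x y -> cls x = cls y.
Proof.
move=> [f i]; have := cls_ses (iso_ses (zobP C) i).
by rewrite (cls_zero (zobP C)) add0r.
Qed.

Lemma short_exact_dsum (x y : C) : short_exact (inj1 x y) (prj2 x y).
Proof.
split; split; rewrite ?prj2_inj1 //.
  move=> w h ph; exists (prj1 x y \oc h); split=> [|u <-].
    by rewrite -[RHS]comp1m -inj_prj compmDl compmA -[inj2 x y \oc _ \oc h]compmA ph compm0 addr0.
  by rewrite compmA prj1_inj1 comp1m.
move=> w h hi; exists (h \oc inj2 x y); split=> [|u <-].
  by rewrite -[RHS]compm1 -inj_prj compmDr !compmA hi comp0m add0r.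
by rewrite -compmA prj2_inj2 compm1.
Qed.

Lemma cls_dsum (x y : C) : cls (dsum x y) = cls x + cls y.
Proof. exact: cls_ses (short_exact_dsum x y). Qed.

Lemma isomorphic_sym (x y : C) : isomorphic x y -> isomorphic y x.
Proof. by case=> f [g [gf fg]]; exists g, f. Qed.

Lemma isomorphic_tensC (x y : C) : isomorphic (x \tens y) (y \tens x).
Proof. by exists (tbraid x y), (tbraid y x); rewrite !tbraidK. Qed.

Lemma tensr_additive (x : C) : ses_additive (fun y : C => cls (x \tens y)).
Proof. by move=> y' y y'' f g s; exact: cls_ses (tens_exact x s). Qed.

Lemma tensl_additive :
  ses_additive (fun x : C => K0_lift (tensr_additive x) : K0 C -> K0 C).
Proof.
move=> x' x x'' f g s; apply/funext.
elim/K0_ind => [y|a b ha hb]; last first.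
  by rewrite raddfB /= ha hb !addrfctE !raddfB /= opprD addrACA.
rewrite addrfctE !K0_liftE !(cls_iso (isomorphic_tensC _ y)).
exact: cls_ses (tens_exact y s).
Qed.

Definition K0_one : K0 C := cls tunit.
Definition K0_mul (a b : K0 C) : K0 C := K0_lift tensl_additive a b.

Lemma K0_mulE x y : K0_mul (cls x) (cls y) = cls (x \tens y).
Proof. by rewrite /K0_mul !K0_liftE. Qed.

Lemma K0_mulBl a a' b : K0_mul (a - a') b = K0_mul a b - K0_mul a' b.
Proof. by rewrite /K0_mul raddfB. Qed.

Lemma K0_mulBr a b b' : K0_mul a (b - b') = K0_mul a b - K0_mul a b'.
Proof.
elim/K0_ind: a => [x|a a' ha ha']; last first.
  by rewrite !K0_mulBl ha ha' !opprD addrACA.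
by rewrite /K0_mul !K0_liftE raddfB.
Qed.

Lemma K0_mulC : commutative K0_mul.
Proof.
elim/K0_ind=> [x|a a' ha ha'] b; last by rewrite K0_mulBl K0_mulBr ha ha'.
elim/K0_ind: b => [y|b b' hb hb']; last by rewrite K0_mulBl K0_mulBr hb hb'.
by rewrite !K0_mulE; apply/cls_iso/isomorphic_tensC.
Qed.

Lemma K0_mulA : associative K0_mul.
Proof.
elim/K0_ind=> [x|a a' ha ha'] b c; last by rewrite !K0_mulBl ha ha'.
elim/K0_ind: b => [y|b b' hb hb']; last by rewrite !(K0_mulBl, K0_mulBr) hb hb'.
elim/K0_ind: c => [z|c c' hc hc']; last by rewrite !K0_mulBr hc hc'.
rewrite !K0_mulE; apply/cls_iso/isomorphic_sym.
by exists (tassoc x y z); apply: tassoc_iso.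
Qed.

Lemma K0_mul1 : left_id K0_one K0_mul.
Proof.
elim/K0_ind=> [x|a a' ha ha']; last by rewrite K0_mulBr ha ha'.
by rewrite K0_mulE; apply: cls_iso; exists (tunitl x); apply: tunitl_iso.
Qed.

Lemma K0_mulDl : left_distributive K0_mul +%R.
Proof. by move=> a a' b; rewrite /K0_mul raddfD. Qed.

Lemma rk_ses_additive : ses_additive (fun x : C => (rk x)%:Z).
Proof. by move=> x' x x'' f g s; rewrite (rk_exact s) PoszD. Qed.

(* e(sum_i n_i [x_i]) = sum_i n_i rk x_i *)
Definition rank : K0 C -> int := K0_lift rk_ses_additive.
HB.instance Definition _ := GRing.Additive.on rank.

Lemma rankE x : rank (cls x) = (rk x)%:Z.
Proof. exact: K0_liftE. Qed.

Lemma K0_one_neq0 : K0_one != 0.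
Proof.
apply/eqP => /(congr1 rank); rewrite rankE rk_unit raddf0; exact/eqP.
Qed.

HB.instance Definition _ := GRing.Zmodule_isComNzRing.Build (K0 C)
  K0_mulA K0_mulC K0_mul1 K0_mulDl K0_one_neq0.

Lemma cls_tens (x y : C) : cls (x \tens y) = cls x * cls y.
Proof. by rewrite -K0_mulE. Qed.

Lemma cls_unit : cls (tunit : C) = 1.
Proof. by []. Qed.

End K0Theory.

(* [f n] is the coefficient of t^n. *)
Definition fps (R : Type) : Type := nat -> R.

Section PowerSeries.
Variable R : comNzRingType.
Implicit Types f g h : fps R.

HB.instance Definition _ := gen_eqMixin (fps R).
HB.instance Definition _ := gen_choiceMixin (fps R).

Definition fps_zero : fps R := fun=> 0.
Definition fps_opp f : fps R := fun n => - f n.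
Definition fps_add f g : fps R := fun n => f n + g n.
Definition fps_one : fps R := fun n => (n == 0%N)%:R.
Definition fps_mul f g : fps R := fun n => \sum_(i < n.+1) f i * g (n - i)%N.

Lemma fps_addA : associative fps_add.
Proof. by move=> f g h; apply/funext => n; exact: addrA. Qed.
Lemma fps_addC : commutative fps_add.
Proof. by move=> f g; apply/funext => n; exact: addrC. Qed.
Lemma fps_add0 : left_id fps_zero fps_add.
Proof. by move=> f; apply/funext => n; exact: add0r. Qed.
Lemma fps_addN : left_inverse fps_zero fps_opp fps_add.
Proof. by move=> f; apply/funext => n; exact: addNr. Qed.

HB.instance Definition _ :=
  GRing.isZmodule.Build (fps R) fps_addA fps_addC fps_add0 fps_addN.

Definition fps_trunc N f : {poly R} := \poly_(i < N) f i.

Lemma coef_trunc N f i : (i < N)%N -> (fps_trunc N f)`_i = f i.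
Proof. by rewrite coef_poly => ->. Qed.

Lemma coef_truncM N f g i : (i < N)%N ->
  (fps_trunc N f * fps_trunc N g)`_i = fps_mul f g i.
Proof.
move=> iN; rewrite coefM; apply: eq_bigr => j _.
rewrite !coef_trunc //; first exact: leq_ltn_trans (leq_subr _ _) iN.
exact: leq_trans (ltn_ord j) _.
Qed.

Lemma coefM_eq N (p p' q q' : {poly R}) :
    (forall i, (i < N)%N -> p`_i = p'`_i) ->
    (forall i, (i < N)%N -> q`_i = q'`_i) ->
  forall i, (i < N)%N -> (p * q)`_i = (p' * q')`_i.
Proof.
move=> hp hq i iN; rewrite !coefM; apply: eq_bigr => j _; rewrite hp ?hq //.
  exact: leq_ltn_trans (leq_subr _ _) iN.
exact: leq_trans (ltn_ord j) _.
Qed.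

Lemma coef_truncMt N f g i : (i < N)%N ->
  (fps_trunc N (fps_mul f g))`_i = (fps_trunc N f * fps_trunc N g)`_i.
Proof. by move=> iN; rewrite coef_trunc // coef_truncM. Qed.

Lemma fps_mulC : commutative fps_mul.
Proof.
by move=> f g; apply/funext => n; rewrite -!(@coef_truncM n.+1) // mulrC.
Qed.

Lemma fps_mulA : associative fps_mul.
Proof.
move=> f g h; apply/funext => n; rewrite -!(@coef_truncM n.+1) //.
transitivity ((fps_trunc n.+1 f * (fps_trunc n.+1 g * fps_trunc n.+1 h))`_n).
  by apply: (@coefM_eq n.+1) => // i iN; rewrite coef_truncMt.
rewrite mulrA; symmetry.
by apply: (@coefM_eq n.+1) => // i iN; rewrite coef_truncMt.
Qed.

Lemma fps_mul1 : left_id fps_one fps_mul.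
Proof.
move=> f; apply/funext => n; rewrite /fps_mul big_ord_recl /= subn0 mul1r.
by rewrite big1 ?addr0 // => i _; rewrite /fps_one /= mul0r.
Qed.

Lemma fps_mulDl : left_distributive fps_mul +%R.
Proof.
move=> f g h; apply/funext => n.
transitivity (\sum_(i < n.+1) (f i * h (n - i)%N + g i * h (n - i)%N)).
  by apply: eq_bigr => i _; exact: mulrDl.
by rewrite big_split.
Qed.

Lemma fps_one_neq0 : fps_one != 0.
Proof. by apply/eqP => /(congr1 (@^~ 0%N))/eqP; rewrite oner_eq0. Qed.

HB.instance Definition _ := GRing.Zmodule_isComNzRing.Build (fps R)
  fps_mulA fps_mulC fps_mul1 fps_mulDl fps_one_neq0.

Lemma fpsD f g n : (f + g) n = f n + g n. Proof. by []. Qed.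
Lemma fpsN f n : (- f) n = - f n. Proof. by []. Qed.
Lemma fps0 n : (0 : fps R) n = 0. Proof. by []. Qed.
Lemma fps1 n : (1 : fps R) n = (n == 0%N)%:R. Proof. by []. Qed.
Lemma fpsM f g n : (f * g) n = \sum_(i < n.+1) f i * g (n - i)%N.
Proof. by []. Qed.

Lemma fps_sum I (r : seq I) (P : pred I) (F : I -> fps R) n :
  (\sum_(i <- r | P i) F i) n = \sum_(i <- r | P i) F i n.
Proof. by elim/big_rec2: _ => // i y z _ <-. Qed.

Lemma fpsX_lt f k n : f 0%N = 0 -> (n < k)%N -> (f ^+ k) n = 0.
Proof.
move=> f0; elim: k n => // k IH n nk.
rewrite exprS fpsM big_ord_recl f0 mul0r add0r big1 // => i _.
rewrite IH ?mulr0 //= (leq_trans _ (nk : (n <= k)%N)) //.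
have := ltn_ord i; rewrite /bump /=; case: n {nk} i => [[]//|n] i _.
by rewrite subSS ltnS leq_subr.
Qed.

(* Inverse of a series with constant term 1: the geometric series in 1 - f. *)
Definition fps_inv f : fps R := fun n => (\sum_(k < n.+1) (1 - f) ^+ k) n.

Lemma fps_geom f N n : f 0%N = 0 -> (n < N)%N ->
  (\sum_(k < N) f ^+ k) n = (\sum_(k < n.+1) f ^+ k) n.
Proof.
move=> f0 /subnK <-; elim: (N - n.+1)%N => [|m IH] //.
by rewrite addSn big_ord_recr /= fpsD IH fpsX_lt ?addr0 // leq_addl.
Qed.

Lemma fps_mulV f : f 0%N = 1 -> f * fps_inv f = 1.
Proof.
move=> f1; pose g := 1 - f; have g0 : g 0%N = 0 by rewrite /g fpsD fpsN f1 subrr.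
apply/funext => n; rewrite fpsM.
transitivity ((f * \sum_(k < n.+1) g ^+ k) n).
  rewrite fpsM; apply: eq_bigr => i _; congr (_ * _).
  by rewrite [RHS]fps_geom // ltnS leq_subr.
have -> : f = 1 - g by rewrite /g subKr.
rewrite -opprB mulNr -subrX1 opprB fpsD fpsN fpsX_lt //.
by rewrite oppr0 addr0.
Qed.

Definition fpsT : fps R := fun n => (n == 1%N)%:R.

(* f(g(t)), meaningful when g has no constant term: then (g ^+ k) n = 0 for
   k > n, and the sum is the full one. *)
Definition fps_comp f g : fps R := fun n => \sum_(k < n.+1) f k * (g ^+ k) n.

(* The group 1 + t R[[t]]: its [+] is the product of power series. *)
Record onefps := Onefps { fps_of : fps R; _ : fps_of 0%N == 1 }.
HB.instance Definition _ := [isSub for fps_of].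
HB.instance Definition _ := [Choice of onefps by <:].

Lemma onefps0 (f : onefps) : fps_of f 0%N = 1. Proof. by case: f => f /= /eqP. Qed.

Lemma onefps_one_subproof : (1 : fps R) 0%N == 1. Proof. by []. Qed.
Lemma onefps_mul_subproof (f g : onefps) : (fps_of f * fps_of g) 0%N == 1.
Proof. by rewrite fpsM big_ord1 !onefps0 mulr1. Qed.
Lemma onefps_inv_subproof (f : onefps) : fps_inv (fps_of f) 0%N == 1.
Proof. by rewrite /fps_inv big_ord1. Qed.

Definition onefps_one := Onefps onefps_one_subproof.
Definition onefps_mul (f g : onefps) := Onefps (onefps_mul_subproof f g).
Definition onefps_inv (f : onefps) := Onefps (onefps_inv_subproof f).

Lemma onefps_mulA : associative onefps_mul.
Proof. by move=> f g h; apply/val_inj; exact: mulrA. Qed.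
Lemma onefps_mulC : commutative onefps_mul.
Proof. by move=> f g; apply/val_inj; exact: mulrC. Qed.
Lemma onefps_mul1 : left_id onefps_one onefps_mul.
Proof. by move=> f; apply/val_inj; exact: mul1r. Qed.
Lemma onefps_mulV : left_inverse onefps_one onefps_inv onefps_mul.
Proof.
move=> f; apply/val_inj; rewrite /= mulrC; exact/fps_mulV/onefps0.
Qed.

HB.instance Definition _ := GRing.isZmodule.Build onefps
  onefps_mulA onefps_mulC onefps_mul1 onefps_mulV.

Lemma onefpsD (f g : onefps) : fps_of (f + g) = fps_of f * fps_of g.
Proof. by []. Qed.

End PowerSeries.

Arguments fpsT {R}.

Section Lambda.
Variable C : ACTEP.

Lemma cls_ext_ses (x' x x'' : C) (f : hom x' x) (g : hom x x'') p :
    short_exact f g ->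
  cls (ext p x) = \sum_(i < p.+1) cls (ext i x') * cls (ext (p - i)%N x'').
Proof.
move=> s; case: p => [|[|p]].
- by rewrite big_ord1 subn0 !(cls_iso (ext0 _)) mulr1.
- rewrite big_ord_recl big_ord1 /= !(cls_iso (ext0 _)) !(cls_iso (ext1 _)).
  by rewrite mul1r mulr1 (cls_ses s) addrC.
have [F [m [j [m0 F0 Fj]]]] := ext_filt s (isT : (2 <= p.+2)%N).
pose G i := cls (ext i x') * cls (ext (p.+2 - i)%N x'').
have FG i : (i <= p.+2)%N -> cls (F i) = G i + cls (F i.+1).
  by move=> /Fj[_ _ [q sq]]; rewrite (cls_ses sq) cls_tens addrC.
have <- : cls (F 0%N) = cls (ext p.+2 x) by apply: cls_iso; exists (m 0%N).
suff H n : (n <= p.+3)%N -> cls (F 0%N) = \sum_(i < n) G i + cls (F n).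
  by rewrite (H p.+3) // (cls_zero F0) addr0.
elim: n => [|n IH] np; first by rewrite big_ord0 add0r.
by rewrite (IH (ltnW np)) (FG n np) addrA big_ord_recr.
Qed.

Definition lambda_obj_fps (x : C) : fps (K0 C) := fun l => cls (ext l x).

Lemma lambda_obj_subproof x : lambda_obj_fps x 0%N == 1.
Proof. by rewrite /lambda_obj_fps (cls_iso (ext0 x)). Qed.

Definition lambda_obj (x : C) : onefps (K0 C) := Onefps (lambda_obj_subproof x).

Lemma lambda_obj_additive : ses_additive lambda_obj.
Proof.
move=> x' x x'' f g s; apply/val_inj/funext => p /=.
by rewrite /lambda_obj_fps (cls_ext_ses p s).
Qed.

Definition lambda_t : K0 C -> onefps (K0 C) := K0_lift lambda_obj_additive.
HB.instance Definition _ := GRing.Additive.on lambda_t.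

Definition lambda (l : nat) (w : K0 C) : K0 C := fps_of (lambda_t w) l.

(* u = t / (1 - t) *)
Definition fps_u : fps (K0 C) := fpsT * fps_inv (1 - fpsT).

Definition gamma_t (w : K0 C) : fps (K0 C) :=
  fps_comp (fps_of (lambda_t w)) fps_u.

Definition gamma (l : nat) (w : K0 C) : K0 C := gamma_t w l.

(* d(w) = e(w) [1] *)
Definition rank_cls (w : K0 C) : K0 C := (rank w)%:~R.

Definition vcc (l : nat) (w : K0 C) : K0 C :=
  (-1) ^+ l * gamma l (w - rank_cls w).

Definition effective (w : K0 C) : Prop :=
  exists s : seq (nat * C),
    all (fun nx => (1 <= nx.1)%N) s /\
    w = \sum_(nx <- s) cls nx.2 *+ nx.1.

Lemma lambda_tD w1 w2 :
  fps_of (lambda_t (w1 + w2)) = fps_of (lambda_t w1) * fps_of (lambda_t w2).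
Proof. by rewrite raddfD. Qed.

Lemma lambda_cls l x : lambda l (cls x) = cls (ext l x).
Proof. by rewrite /lambda /lambda_t K0_liftE. Qed.

Lemma fps_u0 : fps_u 0%N = 0.
Proof. by rewrite /fps_u fpsM big_ord1 /fpsT mul0r. Qed.

(* u (1 - t) = t *)
Lemma fps_uE : fps_u * (1 - fpsT) = fpsT.
Proof.
by rewrite -mulrA [fps_inv _ * _]mulrC fps_mulV ?mulr1 // fpsD fpsN /fpsT subr0.
Qed.

End Lambda.

Record ACTEPfunctor (D C : ACTEP) := MkACTEPfunctor {
  afun :> functor D C;
  afunD : forall (x y : D) (f g : hom x y),
    fmap afun (f + g) = fmap afun f + fmap afun g;
  amul : forall x y : D, hom (afun x \tens afun y) (afun (x \tens y));
  amul_iso : forall x y, is_iso (amul x y);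
  amul_nat : forall (x y x' y' : D) (f : hom x x') (g : hom y y'),
    amul x' y' \oc tensm (fmap afun f) (fmap afun g) =
    fmap afun (tensm f g) \oc amul x y;
  aunit : hom (tunit : C) (afun tunit);
  aunit_iso : is_iso aunit;
  amul_assoc : forall x y z : D,
    fmap afun (tassoc x y z) \oc amul (x \tens y) z
      \oc tensm (amul x y) (idm (afun z)) =
    amul x (y \tens z) \oc tensm (idm (afun x)) (amul y z)
      \oc tassoc (afun x) (afun y) (afun z);
  amul_braid : forall x y : D,
    fmap afun (tbraid x y) \oc amul x y =
    amul y x \oc tbraid (afun x) (afun y);
  amul_unitl : forall x : D,
    fmap afun (tunitl x) \oc amul tunit x \oc tensm aunit (idm (afun x)) =
    tunitl (afun x);
  amul_unitr : forall x : D,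
    fmap afun (tunitr x) \oc amul x tunit \oc tensm (idm (afun x)) aunit =
    tunitr (afun x);
  aext : forall l (x : D), hom (afun (ext l x)) (ext l (afun x));
  aext_iso : forall l x, is_iso (aext l x);
  aext_nat : forall l (x y : D) (f : hom x y),
    aext l y \oc fmap afun (fmap (ext l) f) =
    fmap (ext l) (fmap afun f) \oc aext l x }.

(* [ACTEPfunctor] does not imply the last two conditions.
   [mor_ses] says exactly that [x] |-> [f x] is well defined on K0; it holds
   when f is exact, see [exact_mor_ses].
   [mor_rk]: the rank function is part of the structure of an ACTEP. On graded
   vector spaces, rank functions dim V_0 + 2 dim V_1 and dim V_0 + dim V_1
   define two ACTEPs between which the identity is an exact [ACTEPfunctor];
   it does not commute with c_1(w) = d(w) - w. *)
Record ACTEPmorphism (D C : ACTEP) := MkACTEPmorphism {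
  mfun :> ACTEPfunctor D C;
  mor_ses : ses_additive (fun x : D => cls (mfun x));
  mor_rk : forall x : D, rk (mfun x) = rk x }.

Definition exact_functor (D C : preaddCat) (f : functor D C) :=
  forall (x' x x'' : D) (i : hom x' x) (p : hom x x''),
    short_exact i p -> short_exact (fmap f i) (fmap f p).

Lemma exact_mor_ses (D C : ACTEP) (f : functor D C) :
  exact_functor f -> ses_additive (fun x : D => cls (f x)).
Proof. by move=> ef x' x x'' i p s; exact: cls_ses (ef _ _ _ _ _ s). Qed.

Section InducedMap.
Variables (D C : ACTEP) (f : ACTEPmorphism D C).

Definition K0_map : K0 D -> K0 C := K0_lift (mor_ses f).
HB.instance Definition _ := GRing.Additive.on K0_map.

Lemma K0_mapE x : K0_map (cls x) = cls (f x).
Proof. exact: K0_liftE. Qed.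

Lemma K0_map_is_monoid_morphism : monoid_morphism K0_map.
Proof.
split.
  rewrite -!cls_unit K0_mapE; apply/cls_iso/isomorphic_sym.
  by exists (aunit f); exact: aunit_iso.
elim/K0_ind=> [x|a a' ha ha'] b; last first.
  by rewrite mulrBl !raddfB /= ha ha' mulrBl.
elim/K0_ind: b => [y|b b' hb hb']; last by rewrite mulrBr !raddfB /= hb hb' mulrBr.
rewrite -cls_tens !K0_mapE -cls_tens; apply/cls_iso/isomorphic_sym.
by exists (amul f x y); exact: amul_iso.
Qed.
HB.instance Definition _ :=
  GRing.isMonoidMorphism.Build _ _ K0_map K0_map_is_monoid_morphism.

End InducedMap.

(* Main.v *)
(* Since lambda_t turns sums into products and substituting u = t/(1-t) is a
   ring morphism, w |-> gamma_t (w - d(w)) turns sums into products; this is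
   (1), and it reduces (2) to a single object x of rank r. There
   gamma_t ([x] - r) = (sum_(k <= r) lambda^k(x) u^k) (1 - t)^r because
   1 + u = (1 - t)^-1, and u (1 - t) = t turns this into
   sum_(k <= r) lambda^k(x) t^k (1 - t)^(r - k), of degree at most r.
   For (3), K0_map commutes with lambda_t on classes of objects, hence
   everywhere because power series with constant term 1 can be cancelled. *)
Require Import Defs.
From HB Require Import structures.
From mathcomp Require Import all_boot all_order.
From mathcomp Require Import ssralg ssrnum ssrint poly.
From mathcomp Require Import boolp.

Set Implicit Arguments.
Unset Strict Implicit.
Unset Printing Implicit Defensive.

Import Order.TTheory GRing.Theory Num.Theory.
Local Open Scope ring_scope.

(** * Substitution into power series, and degree bounds *)

Section PowerSeriesTheory.
Variable R : comNzRingType.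
Implicit Types (f g h : fps R) (c : R) (p : {poly R}) (k m n : nat).

(** Scalars as constant series: through this ring morphism a polynomial over [R] can be evaluated at
    a power series. *)
Definition fpsC c : fps R := fun n => if n == 0%N then c else 0.

Lemma fpsC_is_zmod_morphism : zmod_morphism fpsC.
Proof.
move=> a b; apply/funext => n; rewrite fpsD fpsN /fpsC.
by case: eqP => //; rewrite subrr.
Qed.
HB.instance Definition _ :=
  GRing.isZmodMorphism.Build R (fps R) fpsC fpsC_is_zmod_morphism.

Lemma fpsCM c f n : (fpsC c * f) n = c * f n.
Proof.
by rewrite fpsM big_ord_recl big1 ?addr0 ?subn0 // => i _; rewrite mul0r.
Qed.

Lemma fpsC_is_monoid_morphism : monoid_morphism fpsC.
Proof.
split; first by apply/funext => n; rewrite /fpsC fps1; case: eqP.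
by move=> a b; apply/funext => n; rewrite fpsCM /fpsC; case: eqP; rewrite ?mulr0.
Qed.
HB.instance Definition _ :=
  GRing.isMonoidMorphism.Build R (fps R) fpsC fpsC_is_monoid_morphism.

(** [h ^+ k] has no terms below degree [k], so all terms with [k > n] vanish. *)
Lemma fps_comp_wide N f h n : h 0%N = 0 -> (n < N)%N ->
  fps_comp f h n = \sum_(k < N) f k * (h ^+ k) n.
Proof.
move=> h0 nN; rewrite -(big_mkord xpredT (fun k => f k * (h ^+ k) n)).
rewrite (big_cat_nat (leq0n n.+1) nN) /= big_mkord.
rewrite [X in _ + X]big_nat_cond [X in _ + X]big1 ?addr0 //.
by move=> k /andP[/andP[nk _] _]; rewrite fpsX_lt ?mulr0.
Qed.

Lemma eq_fps_comp f g h n : (forall k, (k <= n)%N -> f k = g k) ->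
  fps_comp f h n = fps_comp g h n.
Proof. by move=> fg; apply: eq_bigr => k _; rewrite fg // -ltnS. Qed.

Lemma fps_comp_poly p h : h 0%N = 0 ->
  fps_comp (fun k => p`_k) h = (map_poly fpsC p).[h].
Proof.
move=> h0; apply/funext => n; set N := (size p + n.+1)%N.
have sN : (size (map_poly fpsC p) <= N)%N.
  by rewrite (leq_trans (size_poly _ _)) ?leq_addr.
rewrite (horner_coef_wide _ sN) fps_sum (@fps_comp_wide N) ?leq_addl //.
by apply: eq_bigr => k _; rewrite coef_map fpsCM.
Qed.

(** Coefficient [n] only involves coefficients of [f] and [g] up to [n], so both may be truncated to
    polynomials. There substitution is evaluation at [h], which is multiplicative. *)
Lemma fps_compM f g h : h 0%N = 0 ->
  fps_comp (f * g) h = fps_comp f h * fps_comp g h.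
Proof.
move=> h0; apply/funext => n.
pose p := fps_trunc n.+1 f; pose q := fps_trunc n.+1 g.
transitivity (fps_comp (fun k => (p * q)`_k) h n).
  by apply: eq_fps_comp => k kn; rewrite coef_truncM.
rewrite fps_comp_poly // rmorphM /= hornerM -!fps_comp_poly // !fpsM.
apply: eq_bigr => i _; congr (_ * _); apply: eq_fps_comp => k ki.
  by rewrite coef_trunc // (leq_trans _ (ltn_ord i)).
by rewrite coef_trunc // ltnS (leq_trans ki) ?leq_subr.
Qed.

Lemma fps_comp1 h : fps_comp 1 h = 1.
Proof.
apply/funext => n; rewrite /fps_comp big_ord_recl big1 ?addr0 ?mul1r //.
by move=> i _; rewrite mul0r.
Qed.

Definition fps_deg_le m f := forall n, (m < n)%N -> f n = 0.

Lemma fps_deg_leM m1 m2 f g :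
  fps_deg_le m1 f -> fps_deg_le m2 g -> fps_deg_le (m1 + m2) (f * g).
Proof.
move=> hf hg n mn; rewrite fpsM big1 // => i _.
case: (ltnP m1 i) => [/hf ->|im]; first by rewrite mul0r.
by rewrite hg ?mulr0 // ltn_subRL (leq_ltn_trans _ mn) // leq_add2r.
Qed.

Lemma fps_deg_leX m f k : fps_deg_le m f -> fps_deg_le (k * m) (f ^+ k).
Proof.
move=> hf; elim: k => [|k IH]; first by case.
by rewrite exprS mulSn; apply: fps_deg_leM.
Qed.

Lemma fps_deg_leT : fps_deg_le 1 (fpsT : fps R).
Proof. by case=> [|[]]. Qed.

Lemma fps_deg_le_1subT : fps_deg_le 1 (1 - fpsT : fps R).
Proof. by case=> [|[|n]] // _; rewrite fpsD fpsN subrr. Qed.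

Lemma fps_mulIf h f g : h 0%N = 1 -> f * h = g * h -> f = g.
Proof.
by move=> h1 /(congr1 ( *%R^~ (fps_inv h))); rewrite -!mulrA fps_mulV ?mulr1.
Qed.

End PowerSeriesTheory.

(** * Change of coefficient ring *)

Section PowerSeriesMap.
Variables (R S : comNzRingType) (phi : {rmorphism R -> S}).

Definition fps_map (f : fps R) : fps S := fun n => phi (f n).

Lemma fps_map_is_zmod_morphism : zmod_morphism fps_map.
Proof. by move=> f g; apply/funext => n; exact: rmorphB. Qed.
HB.instance Definition _ :=
  GRing.isZmodMorphism.Build _ _ fps_map fps_map_is_zmod_morphism.

Lemma fps_map_is_monoid_morphism : monoid_morphism fps_map.
Proof.
split; first by apply/funext => n; exact: rmorph_nat.
move=> f g; apply/funext => n; rewrite fpsM /fps_map fpsM rmorph_sum.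
by apply: eq_bigr => i _; exact: rmorphM.
Qed.
HB.instance Definition _ :=
  GRing.isMonoidMorphism.Build _ _ fps_map fps_map_is_monoid_morphism.

Lemma fps_mapT : fps_map fpsT = fpsT.
Proof. by apply/funext => n; exact: rmorph_nat. Qed.

Lemma fps_map_comp f h :
  fps_map (fps_comp f h) = fps_comp (fps_map f) (fps_map h).
Proof.
apply/funext => n; rewrite /fps_map /fps_comp rmorph_sum.
by apply: eq_bigr => k _; rewrite rmorphM -(rmorphXn fps_map).
Qed.

End PowerSeriesMap.

(** * Whitney sum formula and vanishing above the rank *)

Section CharacteristicClasses.
Variable C : ACTEP.
Implicit Types (w a b : K0 C) (x : C).

Lemma gamma_tD a b : gamma_t (a + b) = gamma_t a * gamma_t b.
Proof. by rewrite /gamma_t lambda_tD fps_compM // fps_u0. Qed.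

Lemma gamma_t0 : gamma_t (0 : K0 C) = 1.
Proof. by rewrite /gamma_t raddf0 fps_comp1. Qed.

Lemma gamma_tMn a n : gamma_t (a *+ n) = gamma_t a ^+ n.
Proof.
by elim: n => [|n IH]; rewrite ?mulr0n ?gamma_t0 // mulrS gamma_tD IH exprS.
Qed.

Lemma rank_clsD a b : rank_cls (a + b) = rank_cls a + rank_cls b.
Proof. by rewrite /rank_cls (raddfD (@rank C)) intrD. Qed.

Lemma gamma_tBrankD a b :
  gamma_t (a + b - rank_cls (a + b)) =
  gamma_t (a - rank_cls a) * gamma_t (b - rank_cls b).
Proof. by rewrite -gamma_tD rank_clsD opprD addrACA. Qed.

Lemma vccD l a b : vcc l (a + b) = \sum_(i < l.+1) vcc i a * vcc (l - i)%N b.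
Proof.
rewrite /vcc /gamma gamma_tBrankD fpsM mulr_sumr; apply: eq_bigr => i _.
by rewrite mulrACA -exprD subnKC // -ltnS.
Qed.

Lemma gamma_t_cls x :
  gamma_t (cls x) = \sum_(k < (rk x).+1) fpsC (cls (ext k x)) * fps_u C ^+ k.
Proof.
(* This bound exceeds [n] and splits at [(rk x).+1], beyond which the exterior powers are zero. *)
apply/funext => n; rewrite /gamma_t (@fps_comp_wide _ ((rk x).+1 + n.+1)%N).
- rewrite big_split_ord /= [X in _ + X]big1 ?addr0 ?fps_sum => [|i _].
    by apply: eq_bigr => k _; rewrite fpsCM -lambda_cls.
  rewrite -/(lambda _ _) lambda_cls cls_zero ?mul0r //.
  by apply: ext_gt_rk; rewrite ltnS leq_addr.
- exact: fps_u0.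
- exact: leq_addl.
Qed.

(** Since [lambda_t] of the unit is 1 + t, this is 1 + u = 1/(1 - t). *)
Lemma gamma_t1 : gamma_t (1 : K0 C) * (1 - fpsT) = 1.
Proof.
rewrite -cls_unit gamma_t_cls rk_unit big_ord_recl big_ord1 /=.
rewrite !(cls_iso (ext0 _)) !(cls_iso (ext1 _)) cls_unit rmorph1 !mul1r.
by rewrite expr0 expr1 mulrDl mul1r fps_uE subrK.
Qed.

Lemma gamma_t_deg_le x :
  fps_deg_le (rk x) (gamma_t (cls x - rank_cls (cls x))).
Proof.
have -> : gamma_t (cls x - rank_cls (cls x)) =
    gamma_t (cls x) * (1 - fpsT) ^+ rk x.
  rewrite -[in RHS](subrK (rank_cls (cls x)) (cls x)) [in RHS]gamma_tD.
  rewrite /rank_cls rankE gamma_tMn -mulrA -exprMn gamma_t1 expr1n.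
  by rewrite mulr1.
rewrite gamma_t_cls mulr_suml => n xn; rewrite fps_sum big1 // => k _.
case: k => k /=; rewrite ltnS => kx.
(* Of the [rk x] factors 1 - t, [k] turn u^k into t^k; the others contribute degree at most
   [rk x - k]. *)
rewrite -mulrA -[in _ ^+ rk x](subnKC kx) exprD.
rewrite [_ ^+ k * _]mulrA -exprMn fps_uE fpsCM.
rewrite (fps_deg_leM (fps_deg_leX (@fps_deg_leT _))
  (fps_deg_leX (@fps_deg_le_1subT _))) ?mulr0 //.
by rewrite !muln1 subnKC.
Qed.

(** Under sums, ranks and degree bounds both add. Taking [r] in [nat] also records that the rank, an
    integer, is nonnegative. *)
Lemma effective_gamma_t_deg_le w : effective w ->
  exists2 r : nat, rank w = r & fps_deg_le r (gamma_t (w - rank_cls w)).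
Proof.
pose P a := exists2 r : nat, rank a = r & fps_deg_le r (gamma_t (a - rank_cls a)).
have P0 : P 0.
  by exists 0%N; rewrite ?raddf0 // /rank_cls raddf0 mulr0z subr0 gamma_t0; case.
have PD a b : P a -> P b -> P (a + b).
  move=> [r ra ha] [s sb hb]; exists (r + s)%N.
    by rewrite raddfD /= ra sb.
  by rewrite gamma_tBrankD; apply: fps_deg_leM.
case=> s [_ ->]; apply: (big_ind P) => // -[n x] _ /=.
elim: n => [|n IH]; rewrite ?mulr0n // mulrS; apply: PD => //.
by exists (rk x); [exact: rankE | exact: gamma_t_deg_le].
Qed.

End CharacteristicClasses.

(** * Compatibility with morphisms *)

Section Naturality.
Variables (D C : ACTEP) (f : ACTEPmorphism D C).

Lemma fps_map_lambda_t w :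
  fps_map (K0_map f) (fps_of (lambda_t w)) = fps_of (lambda_t (K0_map f w)).
Proof.
elim/K0_ind: w => [x|a b ha hb].
  apply/funext => l; rewrite K0_mapE -[RHS]/(lambda l _) lambda_cls.
  rewrite /fps_map -/(lambda l _) lambda_cls /= K0_mapE; apply: cls_iso.
  by exists (aext f l x); exact: aext_iso.
(* Multiplying by the series of [b] turns [a - b] into [a] on both sides, so inverses need not be
   compared. *)
apply: (@fps_mulIf _ (fps_of (lambda_t (K0_map f b)))); first exact: onefps0.
by rewrite -lambda_tD -raddfD subrK -hb -rmorphM -lambda_tD subrK.
Qed.

(** The equation u (1 - t) = t determines u and is preserved by any coefficientwise ring
    morphism. *)
Lemma fps_map_u : fps_map (K0_map f) (fps_u D) = fps_u C.
Proof.
apply: (@fps_mulIf _ (1 - fpsT)); first by rewrite fpsD fpsN subr0.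
rewrite fps_uE -[X in _ * (1 - X)](fps_mapT (K0_map f)).
by rewrite -(rmorph1 (fps_map (K0_map f))) -rmorphB -rmorphM fps_uE /= fps_mapT.
Qed.

Lemma K0_map_gamma l w : K0_map f (gamma l w) = gamma l (K0_map f w).
Proof.
by rewrite /gamma /gamma_t -fps_map_lambda_t -fps_map_u -fps_map_comp.
Qed.

(** Makes [rank_cls] commute with [K0_map f]; on classes of objects this is [mor_rk]. *)
Lemma rank_K0_map w : rank (K0_map f w) = rank w.
Proof.
elim/K0_ind: w => [x|a b ha hb]; last by rewrite !raddfB /= ha hb.
by rewrite K0_mapE !rankE mor_rk.
Qed.

Lemma K0_map_vcc l w : K0_map f (vcc l w) = vcc l (K0_map f w).
Proof.
rewrite /vcc rmorphM rmorph_sign /= K0_map_gamma raddfB /=.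
by rewrite /rank_cls rmorph_int rank_K0_map.
Qed.

End Naturality.

Theorem theorem1p2 (C : ACTEP) (l : nat) :
  [/\ forall x y : K0 C,
        vcc l (x + y) = \sum_(i < l.+1) vcc i x * vcc (l - i)%N y,
      forall x : K0 C, effective x -> rank x < l%:Z -> vcc l x = 0
    & forall (D : ACTEP) (f : ACTEPmorphism D C) (x : K0 D),
        K0_map f (vcc l x) = vcc l (K0_map f x)].
Proof.
split=> [x y | x /effective_gamma_t_deg_le[r -> hr] | D f x].
- exact: vccD.
- by rewrite ltz_nat => /hr x0; rewrite /vcc /gamma x0 mulr0.
- exact: K0_map_vcc.
Qed.
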